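(* Let $\mu$ be a probability measure on Cantor space $\{0,1\}^{\mathbb N}$. Suppose there is $r\in\mathbb N$ such that $C(\mu\upharpoonright n)\geq n-r$ for infinitely many $n$. Then $\mu$ is Martin-Löf absolutely continuous, i.e. for every Martin-Löf test $(G_m)_{m\in\mathbb N}$ (with respect to the uniform measure $\lambda$) one has $\inf_m \mu(G_m)=0$.
   Context: $C(x)$ denotes the plain Kolmogorov complexity of a binary string $x$. For a probability measure $\mu$ on $\{0,1\}^{\mathbb N}$, $C(\mu\upharpoonright n):=\sum_{|x|=n} C(x)\,\mu[x]$, where $[x]$ is the set of infinite sequences extending $x$. $\lambda$ is the uniform (fair coin) measure, $\lambda[\sigma]=2^{-|\sigma|}$. A Martin-Löf test is a sequence $(G_m)$ of uniformly effectively open subsets of $\{0,1\}^{\mathbb N}$ (each $G_m=\bigcup_i[\sigma_i]$ for a sequence of strings computable uniformly in $m$) with $\lambda(G_m)\le 2^{-m}$ for all $m$. *)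

(* Defs.v *)
From HB Require Import structures.
From mathcomp Require Import all_boot all_order all_algebra.
From mathcomp Require Import all_classical all_reals all_analysis.
From mathcomp Require Import zify lra.
From mathcomp Require Import measurable_realfun.

Set Implicit Arguments.
Unset Strict Implicit.
Unset Printing Implicit Defensive.

Import Order.TTheory GRing.Theory Num.Theory.
Import numFieldNormedType.Exports.

Local Open Scope classical_set_scope.
Local Open Scope ring_scope.

(** Kleene's schemes. Arities are not recorded in the type: a term of the
    wrong arity for its list of arguments has no value. *)
Inductive recfun : Type :=
| RZero
| RSucc
| RProj of nat
| RComp of recfun & seq recfun
| RPrec of recfun & recfun
| RMu of recfun.

(** [eval f xs y]: the partial function [f] converges on [xs] with value [y]. *)
Inductive eval : recfun -> seq nat -> nat -> Prop :=
| eval_zero xs : eval RZero xs 0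
| eval_succ x : eval RSucc [:: x] x.+1
| eval_proj i xs : (i < size xs)%N -> eval (RProj i) xs (nth 0%N xs i)
| eval_comp f gs xs ys z :
    size ys = size gs ->
    (forall i, (i < size gs)%N ->
      eval (nth RZero gs i) xs (nth 0%N ys i)) ->
    eval f ys z -> eval (RComp f gs) xs z
| eval_prec0 f g xs y : eval f xs y -> eval (RPrec f g) (0%N :: xs) y
| eval_precS f g n xs y z :
    eval (RPrec f g) (n :: xs) y -> eval g (n :: y :: xs) z ->
    eval (RPrec f g) (n.+1 :: xs) z
| eval_mu f xs y (v : nat -> nat) :
    (forall k, (k < y)%N -> eval f (k :: xs) (v k).+1) ->
    eval f (y :: xs) 0 -> eval (RMu f) xs y.

Lemma eval_functional f xs y z : eval f xs y -> eval f xs z -> y = z.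
Proof.
move=> fy; elim: fy z => {f xs y}.
- by move=> xs z H; inversion H.
- by move=> x z H; inversion H.
- by move=> i xs _ z H; inversion H.
- move=> f gs xs ys w szys _ IHg _ IHf z H.
  inversion H as [| | |f' gs' xs' ys' w' szys' Hg Hf| | |]; subst.
  have E : ys = ys'.
    apply: (@eq_from_nth _ 0%N); first by rewrite szys szys'.
    by move=> i; rewrite szys => ilt; apply: (IHg _ ilt); exact: Hg.
  by apply: IHf; rewrite E.
- by move=> f g xs y _ IH z H; inversion H; subst; apply: IH.
- move=> f g n xs y w _ IH1 _ IH2 z H.
  inversion H as [| | | | |f' g' n' xs' y' w' H1 H2|]; subst.
  by rewrite -(IH1 _ H1) in H2; apply: IH2.
- move=> f xs y v _ IHv _ IHy z H.
  inversion H as [| | | | | |f' xs' z' v' Hv Hz]; subst.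
  case: (ltngtP y z) => // yz.
    by have := IHy _ (Hv _ yz).
  by have := IHv _ yz _ Hz.
Qed.

(** Bijective base-2 numeration (digits 1 and 2), least significant digit
    first. *)
Fixpoint str_code (s : seq bool) : nat :=
  if s is b :: t then ((str_code t).*2 + b.+1)%N else 0%N.

Lemma str_code_inj : injective str_code.
Proof.
elim=> [|b s IH] [|c t] //=; [by lia|by lia|].
move=> H.
have bc : b = c by move: b c H => [] []; lia.
by subst c; congr (_ :: _); apply: IH; lia.
Qed.

Lemma str_code_surj n : exists s, str_code s = n.
Proof.
elim/ltn_ind: n => -[_|n IH]; first by exists [::].
have [|s Hs] := IH n./2; first by lia.
by exists (odd n :: s) => /=; rewrite Hs; lia.
Qed.

(** [machine U p x]: the machine given by [U], on program [p], outputs [x]. *)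
Definition machine (U : recfun) (p x : seq bool) : Prop :=
  eval U [:: str_code p] (str_code x).

Definition computable_strings (s : nat -> nat -> seq bool) : Prop :=
  exists f : recfun, forall m i, eval f [:: m; i] (str_code (s m i)).

Definition optimal (U : recfun) : Prop :=
  forall V : recfun, exists c : nat, forall p x, machine V p x ->
    exists2 q, machine U q x & (size q <= size p + c)%N.

(** [+oo] if [x] has no [U]-program, which does not happen when [U] is
    optimal. *)
Definition plain_complexity (R : realType) (U : recfun) (x : seq bool) : \bar R :=
  ereal_inf [set ((size p)%:R)%:E | p in [set p | machine U p x]].

Definition cylinder (s : seq bool) : set cantor_space :=
  [set w | mkseq w (size s) = s].

(** Cantor space with its Borel sigma-algebra, which the (countably many)
    cylinders generate. *)
Definition cantor := g_sigma_algebraType (range cylinder).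

Lemma measurable_cylinder s : measurable (cylinder s : set cantor).
Proof. by apply: sub_sigma_algebra; exists s. Qed.

Section Binary.
Variable R : realType.

Definition doubling (x : R) : R := if x < 2^-1 then 2 * x else 2 * x - 1.

Definition binary (x : R) : cantor := fun n => 2^-1 <= iter n doubling x.

Lemma measurable_doubling : measurable_fun setT doubling.
Proof.
apply: measurable_fun_ifT.
- exact: measurable_fun_ltr.
- exact: measurable_funM.
- by apply: measurable_funB => //; exact: measurable_funM.
Qed.

Lemma cylinder_cons b s (w : cantor) :
  cylinder (b :: s) w <-> w 0%N = b /\ cylinder s (fun n => w n.+1).
Proof.
rewrite /cylinder /mkseq /= (iotaDl 1 0) -map_comp; split; first by case.
by case=> -> ->.
Qed.

Lemma binary_cylinder s : exists a : R, [/\ 0 <= a, a + 2^-1 ^+ size s <= 1 &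
  forall x, 0 <= x < 1 ->
    (cylinder s (binary x) <-> a <= x < a + 2^-1 ^+ size s)].
Proof.
elim: s => [|b s [a [a0 a1 IH]]].
  by exists 0; split; rewrite ?expr0 ?add0r.
have l0 : 0 < (2^-1 : R) ^+ size s by rewrite exprn_gt0// invr_gt0.
have binS x : (fun n => binary x n.+1) = binary (doubling x).
  by apply/funext => n; rewrite /binary iterSr.
exists ((a + b%:R) / 2); split.
- by rewrite divr_ge0// addr_ge0.
- by rewrite /= exprS; case: b => /=; lra.
move=> x /andP[x0 x1].
rewrite cylinder_cons binS /= exprS.
set l := 2^-1 ^+ size s in a1 l0 IH *.
have := IH (doubling x); rewrite /binary /= /doubling.
case: ltP => x2; case: b => /= [] H.
- by split=> [[]//|/andP[]]; lra.
- have /H {}H : 0 <= 2 * x < 1 by lra.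
  by rewrite H; split=> [[_]|]; [|split=> //]; lra.
- have /H {}H : 0 <= 2 * x - 1 < 1 by lra.
  by rewrite H; split=> [[_]|]; [|split=> //]; lra.
- by split=> [[]//|/andP[]]; lra.
Qed.

Lemma measurable_binary : measurable_fun setT binary.
Proof.
have miter n : measurable_fun setT (iter n doubling).
  elim: n => [|n IH]; first exact: measurable_id.
  exact: (measurableT_comp measurable_doubling IH).
apply: (@measurability _ _ _ _ setT binary (range cylinder) erefl).
move=> _ [_ [s _ <-] <-].
have -> : setT `&` binary @^-1` cylinder s =
    \bigcap_(i in [set i | (i < size s)%N])
      ((fun x => 2^-1 <= iter i doubling x) @^-1` [set nth false s i]).
  rewrite setTI; apply/seteqP; split=> x /=.
    move=> Hx i /= ilt.
    by rewrite -Hx nth_mkseq.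
  move=> H; rewrite /cylinder /=; apply: (@eq_from_nth _ false).
    by rewrite size_mkseq.
  by move=> i; rewrite size_mkseq => ilt; rewrite nth_mkseq//; exact: H.
apply: bigcap_measurableType => i _.
rewrite -[X in measurable X]setTI.
by apply: measurable_fun_ler => //; exact: miter.
Qed.

Definition binary_mfun : {mfun measurableTypeR R >-> cantor} :=
  HB.pack binary
    (@isMeasurableFun.Build _ _ (measurableTypeR R) cantor binary
       measurable_binary).

(** The fair coin measure: law of the binary digits of a uniform real in
    [0, 1]. *)
Definition fair_coin : probability cantor R :=
  distribution (uniform_prob (@ltr01 R)) binary_mfun.

Lemma fair_coin_cylinder s :
  fair_coin (cylinder s) = ((2^-1 : R) ^+ size s)%:E.
Proof.
rewrite /fair_coin /= /distribution /pushforward /=.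
rewrite /uniform_prob integral_uniform_pdf.
set B := binary @^-1` cylinder s.
have mB : measurable B.
  rewrite -[X in measurable X]setTI; apply: measurable_binary => //.
  exact: measurable_cylinder.
have mBI : measurable (B `&` `[0%R, 1%R]) by exact: measurableI.
rewrite (eq_integral (fun=> 1%E)); last first.
  move=> x; rewrite inE /= in_itv /= => -[_ x01].
  by rewrite /uniform_pdf x01 subr0 invr1.
rewrite integral_cst// mul1e.
have [a [a0 a1 H]] := binary_cylinder s.
set l := 2^-1 ^+ size s in a1 H *.
have l0 : 0 < l by rewrite exprn_gt0// invr_gt0.
have Il : lebesgue_measure `[a, a + l[%classic = l%:E.
  by rewrite lebesgue_measure_itv /= lte_fin ltrDl l0 -EFinD addrAC subrr add0r.
apply/eqP; rewrite eq_le; apply/andP; split.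
- rewrite -[leRHS]adde0 -[X in (_ + X)%E](lebesgue_measure_set1 (1 : R)) -[X in (X + _)%E]Il.
  apply: le_trans (measureU2 _ _ _) => //.
  apply: le_measure; rewrite ?inE//; first exact: measurableU.
  move=> x [Bx] /=; rewrite in_itv /= => /andP[x0].
  rewrite le_eqVlt => /predU1P[->|x1]; first by right.
  left; rewrite /= in_itv /=; apply/(H x) => //.
  by rewrite x0 x1.
- rewrite -[leLHS]Il; apply: le_measure; rewrite ?inE//.
  move=> x /=; rewrite in_itv /= => /andP[ax xl].
  have x01 : 0 <= x < 1 by lra.
  split; last by rewrite in_itv /=; lra.
  by apply/(H x x01); rewrite ax xl.
Qed.

End Binary.

Definition uniformly_effectively_open (G : nat -> set cantor) : Prop :=
  exists2 s : nat -> nat -> seq bool, computable_strings s &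
    forall m, G m = \bigcup_i cylinder (s m i).

Definition ML_test (R : realType) (G : nat -> set cantor) : Prop :=
  uniformly_effectively_open G /\
  forall m, (fair_coin R (G m) <= ((2^-1 : R) ^+ m)%:E)%E.

Definition ML_absolutely_continuous (R : realType) (mu : probability cantor R)
    : Prop :=
  forall G, ML_test R G -> ereal_inf (range (fun m => mu (G m))) = 0%E.

(** [C(mu|n)], the [mu]-average complexity of strings of length [n]. *)
Definition average_complexity (R : realType) (U : recfun)
    (mu : probability cantor R) (n : nat) : \bar R :=
  (\sum_(x : n.-tuple bool) plain_complexity R U x * mu (cylinder x))%E.

(* Main.v *)
(** If [mu (G_m) > d > 0] for all [m], then for large [n] the strings of length
    [n] covered by (a finite part of) [G_(2m)] carry [mu]-measure at least [d],
    while there are at most [2^(n - 2m)] of them. Such a string is determined by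
    [m], written in unary, and its rank of [n - 2m] bits in the enumeration of
    the covered strings of length [n], so its complexity is at most [n - m + O(1)].
    All other strings of length [n] have complexity at most [n + O(1)], hence
    [C(mu|n) <= n + O(1) - m d], and letting [m] grow contradicts the
    hypothesis. *)

Require Import Defs.
From mathcomp Require Import all_boot all_order all_algebra.
From mathcomp Require Import all_classical all_reals all_analysis.
From mathcomp Require Import zify lra.

Set Implicit Arguments.
Unset Strict Implicit.
Unset Printing Implicit Defensive.

Import Order.TTheory GRing.Theory Num.Theory.
Import numFieldNormedType.Exports.

Local Open Scope nat_scope.

(* [all_analysis] shadows the evaluation relation of [recfun]. *)
Local Notation eval := Defs.eval.

(** * Closure properties of computable functions *)

(* [F t] is computed from the values [e t], [e] in [E]. The parameter type [T] is
   arbitrary, so that entering a binder replaces it by [nat * T]. *)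
Definition computable_from (T : Type) (E : seq (T -> nat)) (F : T -> nat) :=
  exists f, forall t, eval f [seq e t | e <- E] (F t).

Lemma computable_ext T (E : seq (T -> nat)) F G :
  F =1 G -> computable_from E F -> computable_from E G.
Proof. by move=> FG [f Hf]; exists f => t; rewrite -FG. Qed.

Lemma computable_var T (E : seq (T -> nat)) i :
  i < size E -> computable_from E (nth (fun=> 0) E i).
Proof.
move=> iE; exists (RProj i) => t.
rewrite -(nth_map (fun=> 0) 0 (fun e => e t) iE).
by constructor; rewrite size_map.
Qed.

Lemma computable_zero T (E : seq (T -> nat)) : computable_from E (fun=> 0).
Proof. by exists RZero => t; constructor. Qed.

Lemma computable_comp1 T (E : seq (T -> nat)) f (h : nat -> nat) F :
  (forall x, eval f [:: x] (h x)) ->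
  computable_from E F -> computable_from E (fun t => h (F t)).
Proof.
move=> Hf [g Hg]; exists (RComp f [:: g]) => t.
by apply: (@eval_comp _ _ _ [:: F t]) => // -[].
Qed.

Lemma computable_comp2 T (E : seq (T -> nat)) f (h : nat -> nat -> nat) F G :
  (forall x y, eval f [:: x; y] (h x y)) ->
  computable_from E F -> computable_from E G ->
  computable_from E (fun t => h (F t) (G t)).
Proof.
move=> Hf [g Hg] [g' Hg']; exists (RComp f [:: g; g']) => t.
by apply: (@eval_comp _ _ _ [:: F t; G t]) => // -[|[]].
Qed.

Lemma computable_succ T (E : seq (T -> nat)) F :
  computable_from E F -> computable_from E (fun t => (F t).+1).
Proof. by apply: (@computable_comp1 _ _ RSucc) => x; constructor. Qed.

Lemma computable_const T (E : seq (T -> nat)) c : computable_from E (fun=> c).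
Proof. elim: c => [|c]; [exact: computable_zero|exact: computable_succ]. Qed.

(** [RPrec] hands its step the counter and the accumulator before the parameters, whence the
    extended environment; the projections in the witness pass the parameters on unchanged. *)
Lemma computable_rec T (E : seq (T -> nat)) N B (S : nat -> nat -> T -> nat) :
  computable_from E N -> computable_from E B ->
  computable_from [:: (fun p : nat * nat * T => p.1.1), (fun p => p.1.2) &
                      [seq (fun p => e p.2) | e <- E]]
                  (fun p => S p.1.1 p.1.2 p.2) ->
  computable_from E
    (fun t => nat_rect (fun=> nat) (B t) (fun i y => S i y t) (N t)).
Proof.
move=> [fN HN] [fB HB] [fS HS].
exists (RComp (RPrec fB fS) (fN :: [seq RProj i | i <- iota 0 (size E)])) => t.
set xs := [seq e t | e <- E].
apply: (@eval_comp _ _ _ (N t :: xs)) => /=.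
- by rewrite !size_map size_iota.
- move=> [_|i] /=; first exact: HN.
  rewrite ltnS size_map size_iota => iE.
  rewrite (nth_map 0) ?size_iota// nth_iota// add0n.
  by constructor; rewrite size_map.
elim: (N t) => [|n IH]; first by constructor; exact: HB.
apply: (eval_precS IH); have := HS (n, nat_rect (fun=> nat) (B t)
  (fun i y => S i y t) n, t).
by rewrite /= -map_comp.
Qed.

Lemma computable_weak1 T (E : seq (T -> nat)) F : computable_from E F ->
  computable_from ((fun p : nat * T => p.1) :: [seq (fun p => e p.2) | e <- E])
    (fun p => F p.2).
Proof.
move=> [f Hf].
exists (RComp f [seq RProj i.+1 | i <- iota 0 (size E)]) => -[x t].
apply: (@eval_comp _ _ _ [seq e t | e <- E]); last exact: Hf.
  by rewrite !size_map size_iota.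
move=> i; rewrite size_map size_iota => iE.
rewrite (nth_map 0) ?size_iota// nth_iota// add0n.
rewrite /= -map_comp.
by apply: (@eval_proj i.+1 (x :: [seq e t | e <- E])); rewrite /= size_map.
Qed.

Lemma computable_weak2 T (E : seq (T -> nat)) F : computable_from E F ->
  computable_from [:: (fun p : nat * nat * T => p.1.1), (fun p => p.1.2) &
                      [seq (fun p => e p.2) | e <- E]]
    (fun p => F p.2).
Proof.
move=> [f Hf].
exists (RComp f [seq RProj i.+2 | i <- iota 0 (size E)]) => -[[x y] t].
apply: (@eval_comp _ _ _ [seq e t | e <- E]); last exact: Hf.
  by rewrite !size_map size_iota.
move=> i; rewrite size_map size_iota => iE.
rewrite (nth_map 0) ?size_iota// nth_iota// add0n.
rewrite /= -map_comp.
by apply: (@eval_proj i.+2 (x :: y :: [seq e t | e <- E])); rewrite /= size_map.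
Qed.

Lemma computable_add T (E : seq (T -> nat)) F G :
  computable_from E F -> computable_from E G ->
  computable_from E (fun t => F t + G t).
Proof.
move=> HF HG.
apply: (computable_ext _ (computable_rec (S := fun _ y _ => y.+1) HF HG _)) => [t|].
  by elim: (F t) => //= n ->.
apply: computable_succ; exact: (computable_var (i := 1)).
Qed.

Lemma computable_pred T (E : seq (T -> nat)) F : computable_from E F ->
  computable_from E (fun t => (F t).-1).
Proof.
move=> HF.
apply: (computable_ext _ (computable_rec (S := fun i _ _ => i) HF
  (computable_zero E) _)) => [t|]; first by case: (F t).
exact: (computable_var (i := 0)).
Qed.

Lemma computable_mul T (E : seq (T -> nat)) F G :
  computable_from E F -> computable_from E G ->
  computable_from E (fun t => F t * G t).
Proof.
move=> HF HG.
apply: (computable_ext _ (computable_rec (S := fun _ y t => G t + y) HF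
  (computable_zero E) _)) => [t|].
  by elim: (F t) => //= n ->.
apply: computable_add; first exact: computable_weak2.
exact: (computable_var (i := 1)).
Qed.

Lemma computable_sub T (E : seq (T -> nat)) F G :
  computable_from E F -> computable_from E G ->
  computable_from E (fun t => F t - G t).
Proof.
move=> HF HG.
apply: (computable_ext _ (computable_rec (S := fun _ y t => y.-1) HG HF _)) => [t|].
  by elim: (G t) => [|n /= ->]; rewrite ?subn0 ?subnS.
apply: computable_pred; exact: (computable_var (i := 1)).
Qed.

Lemma computable_exp T (E : seq (T -> nat)) F G :
  computable_from E F -> computable_from E G ->
  computable_from E (fun t => F t ^ G t).
Proof.
move=> HF HG.
apply: (computable_ext _ (computable_rec (S := fun _ y t => F t * y) HG
  (computable_const E 1) _)) => [t|].
  by elim: (G t) => //= n ->; rewrite expnS.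
apply: computable_mul; first exact: computable_weak2.
exact: (computable_var (i := 1)).
Qed.

Lemma computable_not T (E : seq (T -> nat)) (P : T -> bool) : computable_from E P ->
  computable_from E (fun t => ~~ P t : nat).
Proof.
move=> HP; apply: (computable_ext _ (computable_sub (computable_const E 1) HP)).
by move=> t; case: (P t).
Qed.

Lemma computable_and T (E : seq (T -> nat)) (P Q : T -> bool) :
  computable_from E P -> computable_from E Q ->
  computable_from E (fun t => P t && Q t : nat).
Proof.
move=> HP HQ; apply: (computable_ext _ (computable_mul HP HQ)).
by move=> t; rewrite mulnb.
Qed.

Lemma computable_leq T (E : seq (T -> nat)) F G :
  computable_from E F -> computable_from E G ->
  computable_from E (fun t => (F t <= G t) : nat).
Proof.
move=> HF HG; apply: (computable_ext _ (computable_sub (computable_const E 1)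
  (computable_sub HF HG))).
by move=> t; case: leqP; lia.
Qed.

Lemma computable_eq T (E : seq (T -> nat)) F G :
  computable_from E F -> computable_from E G ->
  computable_from E (fun t => (F t == G t) : nat).
Proof.
move=> HF HG; apply: (computable_ext _ (computable_and (computable_leq HF HG)
  (computable_leq HG HF))).
by move=> t; rewrite eqn_leq.
Qed.

(** A bounded search or count binds only its index, but the recursion implementing it also carries
    an accumulator, which the projections skip. *)
Lemma computable_weak_acc T (E : seq (T -> nat)) (P : nat -> T -> bool) :
  computable_from ((fun p : nat * T => p.1) :: [seq (fun p => e p.2) | e <- E])
    (fun p => P p.1 p.2) ->
  computable_from [:: (fun p : nat * nat * T => p.1.1), (fun p => p.1.2) &
                      [seq (fun p => e p.2) | e <- E]]
    (fun p => P p.1.1 p.2).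
Proof.
move=> [f Hf].
exists (RComp f (RProj 0 :: [seq RProj i.+2 | i <- iota 0 (size E)])) => -[[x y] t].
have := Hf (x, t); rewrite /= -map_comp => Hf'.
apply: (eval_comp _ _ Hf'); first by rewrite /= !size_map size_iota.
move=> [_|i]; first by apply: (@eval_proj 0).
rewrite /= size_map size_iota => iE.
rewrite (nth_map 0) ?size_iota// nth_iota// add0n -map_comp.
by apply: (@eval_proj i.+2 (x :: y :: [seq e t | e <- E])); rewrite /= size_map.
Qed.

(** * Bounded counting and search *)

Lemma computable_count T (E : seq (T -> nat)) N (P : nat -> T -> bool) :
  computable_from E N ->
  computable_from ((fun p : nat * T => p.1) :: [seq (fun p => e p.2) | e <- E])
    (fun p => P p.1 p.2) ->
  computable_from E (fun t => count (fun i => P i t) (iota 0 (N t))).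
Proof.
move=> HN /computable_weak_acc HP.
apply: (computable_ext _ (computable_rec (S := fun i y t => y + P i t) HN
  (computable_zero E) _)) => [t|].
  elim: (N t) => [//|n IH].
  by rewrite [LHS]/= IH -addn1 iotaD count_cat /= add0n addn0.
by apply: computable_add; first exact: (computable_var (i := 1)).
Qed.

Lemma computable_find T (E : seq (T -> nat)) N (P : nat -> T -> bool) :
  computable_from E N ->
  computable_from ((fun p : nat * T => p.1) :: [seq (fun p => e p.2) | e <- E])
    (fun p => P p.1 p.2) ->
  computable_from E (fun t => find (fun i => P i t) (iota 0 (N t))).
Proof.
move=> HN /computable_weak_acc HP.
(* The accumulator equals the counter as long as no witness has appeared; at the first witness it
   stops growing, and lagging behind the counter it stays there. *)
apply: (computable_ext _ (computable_rec
  (S := fun i y t => y + ((y == i) && ~~ P i t)) HN (computable_zero E) _)) => [t|].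
  elim: (N t) => [//|n IH].
  rewrite [LHS]/= IH -addn1 iotaD find_cat /= add0n has_find size_iota.
  have := find_size (P^~ t) (iota 0 n); rewrite size_iota leq_eqVlt.
  case/predU1P => [->|fn]; first by rewrite ltnn eqxx; case: (P n t).
  by rewrite fn ltn_eqF// addn0.
apply: computable_add; first exact: (computable_var (i := 1)).
apply: computable_and; last exact: computable_not.
apply: computable_eq; first exact: (computable_var (i := 1)).
exact: (computable_var (i := 0)).
Qed.

Lemma computable_has T (E : seq (T -> nat)) N (P : nat -> T -> bool) :
  computable_from E N ->
  computable_from ((fun p : nat * T => p.1) :: [seq (fun p => e p.2) | e <- E])
    (fun p => P p.1 p.2) ->
  computable_from E (fun t => has (fun i => P i t) (iota 0 (N t)) : nat).
Proof.
move=> HN HP.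
apply: (computable_ext _ (computable_leq (computable_succ (computable_find HN HP)) HN)).
by move=> t; rewrite has_find size_iota.
Qed.

Lemma find_iotaP (P : pred nat) k n :
  k < n -> P k -> (forall i, i < k -> ~~ P i) -> find P (iota 0 n) = k.
Proof.
move=> kn Pk min; have hP : has P (iota 0 n).
  by apply/hasP; exists k => //; rewrite mem_iota.
have := nth_find 0 hP; move: (hP); rewrite has_find size_iota => fn.
rewrite nth_iota// add0n => Pf.
case: (ltngtP (find P (iota 0 n)) k) => // fk.
  by move: (min _ fk); rewrite Pf.
by have := before_find 0 fk; rewrite nth_iota// add0n Pk.
Qed.

Lemma computable_trunc_log2 T (E : seq (T -> nat)) F :
  computable_from E F -> computable_from E (fun t => trunc_log 2 (F t)).
Proof.
(* The logarithm is the least [i] with [F t < 2 ^ i.+1]; for [F t = 0] the search returns 0, in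
   agreement with [trunc_log]. *)
move=> HF; apply: (computable_ext _ (@computable_find _ E (fun t => (F t).+1)
  (fun i t => F t < 2 ^ i.+1) _ _)) => [t||].
- have [->|F0] := posnP (F t); first by rewrite trunc_log0.
  have /andP[lo hi] := trunc_log_bounds (isT : 1 < 2) F0.
  apply: find_iotaP => // [|i ilt].
    by rewrite ltnS (leq_trans _ lo)// ltnW// ltn_expl.
  by rewrite -leqNgt (leq_trans _ lo)// leq_exp2l.
- exact: computable_succ.
- apply: computable_leq; first exact: computable_succ (computable_weak1 HF).
  apply: computable_exp; first exact: computable_const.
  exact: computable_succ (computable_var (i := 0) _).
Qed.

(** Index 0 is the innermost binder. The deepest nesting, in [answers], is three binders over two
    arguments, hence five indices. *)
Ltac computable_step := first
  [ exact: (computable_var (i := 0)) | exact: (computable_var (i := 1))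
  | exact: (computable_var (i := 2)) | exact: (computable_var (i := 3))
  | exact: (computable_var (i := 4))
  | exact: computable_const | apply: computable_succ | apply: computable_not
  | apply: computable_and | apply: computable_leq | apply: computable_eq
  | apply: computable_add | apply: computable_mul
  | apply: computable_exp | apply: computable_trunc_log2
  | apply: computable_has | apply: computable_count | apply: computable_find ].

Ltac computable := repeat computable_step.

(** * Pairs and strings as numbers *)

(* Every [e] is uniquely of the form [2 ^ t * (2 * x).+1 - 1]. *)
Definition unpair1 e :=
  find (fun t => has (fun x => e.+1 == 2 ^ t * (2 * x).+1) (iota 0 e.+1))
       (iota 0 e.+1).

Definition unpair2 e :=
  find (fun x => e.+1 == 2 ^ unpair1 e * (2 * x).+1) (iota 0 e.+1).

(** Parity separates a zero exponent from a positive one; two positive exponents let a factor 2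
    cancel. *)
Lemma pair_inj t x t' x' :
  2 ^ t * (2 * x).+1 = 2 ^ t' * (2 * x').+1 -> t = t' /\ x = x'.
Proof.
elim: t t' => [|t IH] [|t'].
- rewrite !expn0; lia.
- rewrite expnS expn0; lia.
- rewrite expnS expn0; lia.
- rewrite !expnS => H; have [|-> ->] := IH t'; last by [].
  by move: H; rewrite -!mulnA => /eqP; rewrite eqn_pmul2l// => /eqP.
Qed.

Lemma unpairP t x e : e.+1 = 2 ^ t * (2 * x).+1 -> unpair1 e = t /\ unpair2 e = x.
Proof.
move=> E.
have te : t < e.+1.
  by rewrite E (leq_trans (ltn_expl t (isT : 1 < 2)))// leq_pmulr.
have xe : x < e.+1.
  by rewrite E (leq_trans _ (leq_pmull _ _)) ?expn_gt0//; lia.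
have e1 : unpair1 e = t.
  apply: find_iotaP => //.
    by apply/hasP; exists x; rewrite ?mem_iota// E.
  move=> i it; apply/hasPn => y _; apply/negP => /eqP.
  by rewrite E => /pair_inj[] ti; rewrite ti ltnn in it.
split=> //; rewrite /unpair2 e1; apply: find_iotaP => //; first by rewrite E.
move=> i ix; apply/negP => /eqP.
by rewrite E => /pair_inj[_] xi; rewrite xi ltnn in ix.
Qed.

Lemma unpair_surj t x : exists e, unpair1 e = t /\ unpair2 e = x.
Proof.
exists (2 ^ t * (2 * x).+1).-1; apply: unpairP.
by rewrite prednK// muln_gt0 expn_gt0.
Qed.

Lemma computable_unpair1 T (E : seq (T -> nat)) F :
  computable_from E F -> computable_from E (fun t => unpair1 (F t)).
Proof.
have [f Hf] : computable_from [:: id] unpair1 by rewrite /unpair1; computable.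
by apply: (computable_comp1 (f := f)).
Qed.

Lemma computable_unpair2 T (E : seq (T -> nat)) F :
  computable_from E F -> computable_from E (fun t => unpair2 (F t)).
Proof.
have [f Hf] : computable_from [:: id] unpair2.
  by rewrite /unpair2; computable; apply: computable_unpair1; computable.
by apply: (computable_comp1 (f := f)).
Qed.

(** In bijective base 2 the codes of strings of length [n] fill the interval from [2 ^ n - 1] to
    [2 ^ n.+1 - 2], so the length is a binary logarithm. *)
Lemma str_code_bounds s : 2 ^ size s <= (str_code s).+1 < 2 ^ (size s).+1.
Proof. elim: s => //= b s; rewrite !expnS; case: b => /=; lia. Qed.

Lemma trunc_log_str_code s : trunc_log 2 (str_code s).+1 = size s.
Proof. by apply: trunc_log_eq => //; exact: str_code_bounds. Qed.

Lemma str_code_cat s t :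
  str_code (s ++ t) = str_code s + 2 ^ size s * str_code t.
Proof. elim: s => [|b s IH] /=; rewrite ?mul1n// IH expnS; lia. Qed.

(** The prefix occupies the low digits, so [z] is the code of the remaining suffix and
    [2 ^ trunc_log 2 Y.+1] shifts it past the prefix. *)
Definition code_prefix Y X :=
  has (fun z => X == Y + 2 ^ trunc_log 2 Y.+1 * z) (iota 0 X.+1).

Lemma code_prefixE s t : code_prefix (str_code s) (str_code t) = prefix s t.
Proof.
rewrite /code_prefix trunc_log_str_code; apply/hasP/prefixP => [[z _ /eqP]|[u ->]].
  have [u <-] := str_code_surj z.
  by rewrite -str_code_cat => /str_code_inj ->; exists u.
exists (str_code u); last by rewrite str_code_cat.
rewrite mem_iota str_code_cat add0n ltnS /=.
by rewrite (leq_trans _ (leq_addl _ _))// leq_pmull// expn_gt0.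
Qed.

(** * The enumerating machine *)

Section Enumeration.
Variable s : nat -> nat -> seq bool.

(* Stage [e] enumerates the code [unpair2 e] of a string of length [n] when the
   [unpair1 e]-th cylinder of [G_M] covers it and no earlier stage did so. *)
Definition enumerates M n e :=
  [&& trunc_log 2 (unpair2 e).+1 == n,
      code_prefix (str_code (s M (unpair1 e))) (unpair2 e) &
      ~~ has (fun e' => (unpair2 e' == unpair2 e) &&
                code_prefix (str_code (s M (unpair1 e'))) (unpair2 e)) (iota 0 e)].

(* The program [N = 2 ^ m * (2 * (2 ^ a + j)).+1 - 1] asks for the [j]-th string
   of length [2 * m + a] covered by [G_(2 * m)]. *)
Definition answers N e :=
  let M := 2 * unpair1 N in let K := unpair2 N in
  let a := trunc_log 2 K in
  enumerates M (M + a) e && (count (enumerates M (M + a)) (iota 0 e) + 2 ^ a == K).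

(** The stage comes before the program because [RMu] searches on the first argument. *)
Lemma computable_answers : computable_strings s ->
  computable_from [:: fst; snd] (fun p => answers p.2 p.1).
Proof.
move=> [f Hf].
have computable_s T (E : seq (T -> nat)) F G :
    computable_from E F -> computable_from E G ->
    computable_from E (fun t => str_code (s (F t) (G t))).
  by apply: (computable_comp2 (f := f) (h := fun m i => str_code (s m i))).
rewrite /answers /enumerates /code_prefix.
by repeat first [apply: computable_s | apply: computable_unpair1
  | apply: computable_unpair2 | computable_step].
Qed.

(** Only cylinders given by strings of length at most [n] count here, so the covered strings may
    represent a proper part of [G_M]. *)
Definition covered M n : pred (n.-tuple bool) :=
  fun x => `[< exists i, prefix (s M i) x >].
Arguments covered : clear implicits.

(** Of two stages listing the same code, the later one is excluded by the earlier. *)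
Lemma enumerates_inj M n : {in enumerates M n &, injective unpair2}.
Proof.
move=> e e' /and3P[_ pe /hasPn he] /and3P[_ pe' /hasPn he'] E.
wlog ee' : e e' pe he pe' he' E / e < e'.
  by move=> W; case: (ltngtP e e') => // ?; [apply: W|apply/esym; apply: W].
have := he' e; rewrite mem_iota /= add0n ee' => /(_ isT).
by rewrite E eqxx -E pe.
Qed.

Lemma count_enumerates M n t :
  count (enumerates M n) (iota 0 t) <= #|covered M n|.
Proof.
rewrite -size_filter -(size_map unpair2).
rewrite cardE -(size_map (fun x : n.-tuple bool => str_code x)).
apply: uniq_leq_size.
  rewrite map_inj_in_uniq ?filter_uniq ?iota_uniq// => e e'.
  by rewrite !mem_filter => /andP[He _] /andP[He' _]; exact: (@enumerates_inj M n).
move=> X /mapP[e]; rewrite mem_filter => /andP[/and3P[/eqP len pre _] _] ->.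
have [x Ex] := str_code_surj (unpair2 e).
move: len pre; rewrite -Ex trunc_log_str_code code_prefixE => /eqP sx pre.
apply/mapP; exists (Tuple sx) => //.
by rewrite mem_enum; apply/asboolP; exists (unpair1 e).
Qed.

(** Pairing is surjective, so some stage presents the string together with a cylinder covering it;
    the least such stage enumerates it. *)
Lemma enumerates_covered M n (x : n.-tuple bool) : covered M n x ->
  exists2 e, enumerates M n e & unpair2 e = str_code x.
Proof.
move=> /asboolP[i pre].
pose P e := (unpair2 e == str_code x) &&
  code_prefix (str_code (s M (unpair1 e))) (unpair2 e).
have exP : exists e, P e.
  have [e [e1 e2]] := unpair_surj i (str_code x).
  by exists e; rewrite /P e1 e2 eqxx code_prefixE.
case: (ex_minnP exP) => e /andP[/eqP ex pe] min.
exists e => //; apply/and3P; split=> //.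
  by rewrite ex trunc_log_str_code size_tuple.
apply/hasPn => e'; rewrite mem_iota add0n => /andP[_ e'e]; apply/negP => /andP[/eqP E pe'].
by have := min e'; rewrite /P E ex eqxx -ex pe' leqNgt e'e => /(_ isT).
Qed.

Lemma covered_program m n : 2 * m <= n -> #|covered (2 * m) n| <= 2 ^ (n - 2 * m) ->
  forall x : n.-tuple bool, covered (2 * m) n x ->
  exists p e, [/\ size p <= n - m + 1, answers (str_code p) e & unpair2 e = str_code x].
Proof.
move=> mn card x /enumerates_covered[e en ex].
set a := n - 2 * m in card.
pose j := count (enumerates (2 * m) n) (iota 0 e).
(* Counting through stage [e] includes [x] itself, so its rank is strictly below the number of
   covered strings. *)
have ja : j < 2 ^ a.
  have := count_enumerates (2 * m) n e.+1.
  rewrite -[e.+1]addn1 iotaD count_cat /= add0n en addn0 addn1 => /leq_trans; exact.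
(* The leading bit [2 ^ a] keeps the width of the rank readable, so the length is recovered as
   [2 * m + a]. *)
pose N := 2 ^ m * (2 * (2 ^ a + j)).+1.
have N0 : 0 < N by rewrite muln_gt0 expn_gt0.
have [p Ep] := str_code_surj N.-1.
have [p1 p2] : unpair1 (str_code p) = m /\ unpair2 (str_code p) = 2 ^ a + j.
  by apply: unpairP; rewrite Ep prednK.
exists p, e; split=> //.
  have /andP[lo _] := str_code_bounds p.
  rewrite Ep prednK// in lo.
  (* The factor [2 ^ m] takes [m] bits, [2 ^ a + j] takes [a + 1], the odd form one more. The
     program is one bit shorter than [N], and [m + a] is [n - m]. *)
  have hi : N < 2 ^ (m + (a + 2)).
    rewrite expnD ltn_pmul2l ?expn_gt0// expnD; lia.
  by have := leq_ltn_trans lo hi; rewrite ltn_exp2l//; lia.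
have la : trunc_log 2 (2 ^ a + j) = a.
  by apply: trunc_log_eq => //; rewrite expnS; lia.
by rewrite /answers p1 p2 la (_ : 2 * m + a = n) ?subnKC// en addnC eqxx.
Qed.

(** The machine finds the first stage answering the program and outputs the code listed there. [RMu]
    looks for a zero, hence the negated predicate, with value 1 at earlier stages. *)
Lemma machine_covered : computable_strings s -> exists V : recfun,
  forall p e x, answers (str_code p) e -> unpair2 e = str_code x -> machine V p x.
Proof.
move=> /computable_answers/computable_not[f Hf].
have [g Hg] : computable_from [:: id] unpair2.
  by apply: computable_unpair2; exact: (computable_var (i := 0)).
exists (RComp g [:: RMu f]) => p e x ans ex.
apply: (@eval_comp _ _ _ [:: e]) => //; last by rewrite -ex; exact: Hg.
case=> // _ /=; apply: (@eval_mu _ _ _ (fun=> 0)) => [k ke|].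
- have := Hf (k, str_code p); rewrite /= (_ : answers _ k = false)//.
  (* Two answering stages would share the same rank, but the count grows strictly past an
     enumerating stage. *)
  apply/negP => /andP[enk /eqP ck]; move: ans => /andP[_ /eqP ce].
  have /addIn {}ck := etrans ck (esym ce).
  set P := enumerates _ _ in ck enk.
  have : count P (iota 0 k.+1) <= count P (iota 0 e).
    by rewrite -(subnKC ke) iotaD count_cat leq_addr.
  by rewrite -[k.+1]addn1 iotaD count_cat /= add0n enk ck addn0 addn1 ltnn.
- by have := Hf (e, str_code p); rewrite /= ans.
Qed.

End Enumeration.

Arguments covered : clear implicits.

(** * Measure and average complexity *)

Local Open Scope classical_set_scope.
Local Open Scope ring_scope.

Section Measure.
Variables (R : realType) (mu : probability cantor R).

(** Cylinders of distinct strings of the same length are disjoint. *)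
Lemma measure_cylinders n (A : pred (n.-tuple bool)) :
  mu (\bigcup_(x in [set` A]) cylinder x) = (\sum_(x | A x) mu (cylinder x))%E.
Proof.
rewrite measure_fin_bigcup//.
- rewrite -(@bigfs _ _ _ _ (index_enum _)) ?index_enum_uniq// => x _.
  by rewrite mem_index_enum.
- move=> x y _ _ [w []]; rewrite /cylinder /= !size_tuple => Hx Hy.
  by apply: val_inj; rewrite /= -Hx Hy.
- by move=> x _; exact: measurable_cylinder.
Qed.

Lemma sum_cylinders n : (\sum_(x : n.-tuple bool) mu (cylinder x) = 1)%E.
Proof.
rewrite -(@measure_cylinders n predT) -(probability_setT mu).
congr (mu _); apply/seteqP; split=> // w _.
by exists [tuple of mkseq w n] => //; rewrite /cylinder /= size_mkseq.
Qed.

Lemma bigcup_covered_sub (s : nat -> nat -> seq bool) M n :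
  \bigcup_(x in [set` covered s M n]) cylinder x `<=` \bigcup_i cylinder (s M i).
Proof.
move=> w [x /asboolP[i /prefixP[t xE]] wx]; exists i => //.
move: wx; rewrite /cylinder /= xE => H.
rewrite -[RHS](take_size_cat t (erefl (size (s M i)))) -H.
rewrite size_cat /mkseq -map_take take_iota.
by rewrite (minn_idPl (leq_addr _ _)).
Qed.

Lemma sub_bigcup_covered (s : nat -> nat -> seq bool) M n k :
  (forall i, (i < k)%N -> (size (s M i) <= n)%N) ->
  \bigcup_(i < k) cylinder (s M i) `<=` \bigcup_(x in [set` covered s M n]) cylinder x.
Proof.
move=> sz w [i /= ik wi]; exists [tuple of mkseq w n]; last first.
  by rewrite /cylinder /= size_mkseq.
apply/asboolP; exists i; rewrite prefixE /= -[X in _ == X]wi.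
by rewrite /mkseq -map_take take_iota (minn_idPl (sz _ ik)).
Qed.

Lemma measurable_bigcup_cylinder (f : nat -> seq bool) (D : set nat) :
  measurable (\bigcup_(i in D) cylinder (f i) : set cantor).
Proof. by apply: bigcup_measurable => i _; exact: measurable_cylinder. Qed.

(** By continuity from below, finitely many cylinders already have measure above [d]; once [n]
    reaches the longest of their strings, they split into cylinders of covered strings. *)
Lemma covered_measure (s : nat -> nat -> seq bool) M (d : R) :
  (d%:E < mu (\bigcup_i cylinder (s M i)))%E ->
  exists N, forall n, (N <= n)%N ->
    (d%:E <= \sum_(x | covered s M n x) mu (cylinder x))%E.
Proof.
move=> dmu; set F := fun k => \bigcup_(i < k) cylinder (s M i).
have FE : \bigcup_k F k = \bigcup_i cylinder (s M i).
  apply/seteqP; split=> w [i _]; first by move=> [j _ ?]; exists j.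
  by move=> wi; exists i.+1 => //; exists i => /=.
have [k dk] : exists k, (d%:E < mu (F k))%E.
  apply/not_existsP => H; move: dmu; apply/negP; rewrite -leNgt -FE.
  have mF k : measurable (F k : set cantor) by exact: measurable_bigcup_cylinder.
  have cv : mu \o F @ \oo --> mu (\bigcup_k F k).
    apply: nondecreasing_cvg_mu => //.
      by rewrite FE; exact: measurable_bigcup_cylinder.
    move=> a b ab; apply/subsetPset => w [i ia wi]; exists i => //.
    exact: leq_trans ia ab.
  rewrite -(cvg_lim _ cv)//; apply: lime_le; first by apply/cvg_ex; eexists; exact: cv.
  by apply: nearW => k; rewrite leNgt; apply/negP; exact: H.
exists (\max_(i < k) size (s M i))%N => n Nn.
rewrite -measure_cylinders (le_trans (ltW dk))//.
apply: le_measure; rewrite ?inE; [exact: measurable_bigcup_cylinder| |].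
  apply: fin_bigcup_measurable => // x _; exact: measurable_cylinder.
apply: sub_bigcup_covered => i ik.
by rewrite (leq_trans _ Nn)// (leq_bigmax (F := fun i : 'I_k => size (s M i)) (Ordinal ik)).
Qed.

End Measure.

(** Each covered string contributes [2 ^ - n] to a total fair-coin measure of at most [2 ^ - M]. *)
Lemma card_covered (R : realType) (s : nat -> nat -> seq bool) M n : (M <= n)%N ->
  (fair_coin R (\bigcup_i cylinder (s M i)) <= ((2^-1 : R) ^+ M)%:E)%E ->
  (#|covered s M n| <= 2 ^ (n - M))%N.
Proof.
move=> Mn small.
have : (fair_coin R (\bigcup_(x in [set` covered s M n]) cylinder x) <=
        ((2^-1 : R) ^+ M)%:E)%E.
  apply: le_trans small; apply: le_measure; rewrite ?inE.
  - apply: fin_bigcup_measurable => // x _; exact: measurable_cylinder.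
  - exact: measurable_bigcup_cylinder.
  - exact: bigcup_covered_sub.
rewrite measure_cylinders (eq_bigr (fun=> ((2^-1 : R) ^+ n)%:E)); last first.
  by move=> x _; rewrite fair_coin_cylinder size_tuple.
rewrite -/(covered s M n) sumEFin lee_fin sumr_const -[X in X <= _]mulr_natl.
have -> : (2^-1 : R) ^+ n = 2^-1 ^+ (n - M) * 2^-1 ^+ M by rewrite -exprD subnK.
rewrite mulrA ger_pMl ?exprn_gt0//.
rewrite exprVn ler_pdivrMr ?exprn_gt0// mul1r -natrX ler_nat.
exact.
Qed.

(** * Upper bounds on plain and average complexity *)

Section Complexity.
Variables (R : realType) (U : recfun).

Lemma plain_complexity_le x p k : machine U p x -> (size p <= k)%N ->
  (plain_complexity R U x <= (k%:R)%:E)%E.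
Proof.
move=> Upx pk; apply: ge_ereal_inf; exists ((size p)%:R)%:E; first by exists p.
by rewrite lee_fin ler_nat.
Qed.

Hypothesis hU : optimal U.

(** The first projection is the machine that copies its program. *)
Lemma plain_complexity_size : exists c, forall x,
  (plain_complexity R U x <= ((size x + c)%:R)%:E)%E.
Proof.
have [c Hc] := hU (RProj 0); exists c => x.
have [|q Uq qs] := Hc x x; last exact: plain_complexity_le Uq qs.
exact: (@eval_proj 0 [:: str_code x]).
Qed.

Lemma plain_complexity_covered (s : nat -> nat -> seq bool) :
  computable_strings s ->
  (forall M, (fair_coin R (\bigcup_i cylinder (s M i)) <= ((2^-1 : R) ^+ M)%:E)%E) ->
  exists c, forall m n (x : n.-tuple bool), (2 * m <= n)%N -> covered s (2 * m) n x ->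
    (plain_complexity R U x <= ((n - m + c)%:R)%:E)%E.
Proof.
move=> cs small; have [V HV] := machine_covered cs; have [c Hc] := hU V.
(* The 1 comes from the program length in [covered_program], [c] from simulating [V]. Since [V]
   depends only on [s], the constant is uniform in [m] and [n]. *)
exists (1 + c)%N => m n x mn cx.
have [p [e [sp /HV/[apply]/Hc[q Uq qs]]]] :=
  covered_program mn (card_covered mn (small _)) cx.
by apply: plain_complexity_le Uq _; lia.
Qed.

Lemma average_complexity_le (mu : probability cantor R) (s : nat -> nat -> seq bool) :
  computable_strings s ->
  (forall M, (fair_coin R (\bigcup_i cylinder (s M i)) <= ((2^-1 : R) ^+ M)%:E)%E) ->
  exists c : nat, forall m n (d : R), (2 * m <= n)%N ->
    (d%:E <= \sum_(x | covered s (2 * m) n x) mu (cylinder x))%E ->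
    (average_complexity U mu n <= (n%:R + c%:R - m%:R * d)%:E)%E.
Proof.
move=> cs small.
have [c1 H1] := plain_complexity_size.
have [c2 H2] := plain_complexity_covered cs small.
exists (c1 + c2)%N => m n d mn.
pose p (x : n.-tuple bool) := fine (mu (cylinder x)).
have pE (x : n.-tuple bool) : mu (cylinder x) = (p x)%:E.
  by rewrite /p fineK// fin_num_measure//; exact: measurable_cylinder.
have p0 x : 0 <= p x by rewrite fine_ge0.
have p1 : \sum_x p x = 1.
  apply: EFin_inj; rewrite -sumEFin -(sum_cylinders mu n).
  by apply: eq_bigr => x _; rewrite pE.
under eq_bigr do rewrite pE.
rewrite sumEFin lee_fin => dA.
(* Every string is bounded by [n] plus a constant, and covered strings save [m]. *)
apply: (@le_trans _ _ (\sum_(x : n.-tuple bool)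
    ((n%:R + (c1 + c2)%:R - (if covered s (2 * m) n x then m%:R else 0)) * p x)%:E)%E).
  apply: lee_sum => x _; rewrite pE EFinM; apply: lee_wpmul2r; first by rewrite lee_fin.
  case: ifPn => cx.
    apply: le_trans (H2 _ _ _ mn cx) _.
    rewrite lee_fin natrD natrB ?natrD; last by lia.
    have := ler0n R c1; lra.
  apply: le_trans (H1 _) _.
  by rewrite lee_fin size_tuple subr0 !natrD addrA lerDl ler0n.
rewrite sumEFin lee_fin.
under eq_bigr do rewrite mulrBl.
(* As the total mass is 1, it remains to see that the saving weighted by the covered mass is at
   least [m * d]. *)
rewrite sumrB -mulr_sumr p1 mulr1 lerD2l lerN2.
rewrite (eq_bigr (fun x => if covered s (2 * m) n x then m%:R * p x else 0)); last first.
  by move=> x _; case: ifP; rewrite ?mul0r.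
by rewrite -big_mkcond -mulr_sumr ler_wpM2l.
Qed.

End Complexity.

Theorem theorem3p6 (R : realType) (U : recfun) (hU : optimal U)
    (mu : probability cantor R) (r : nat)
    (hmu : forall N : nat, exists2 n : nat, (N <= n)%N &
      ((n%:R - r%:R : R)%:E <= average_complexity U mu n)%E) :
  ML_absolutely_continuous mu.
Proof.
move=> G [[s cs GE] small].
have {}small M : (fair_coin R (\bigcup_i cylinder (s M i)) <= ((2^-1 : R) ^+ M)%:E)%E.
  by rewrite -GE.
have [c Hc] := average_complexity_le hU mu cs small.
apply/eqP; rewrite eq_le; apply/andP; split; last first.
  by apply: le_ereal_inf_tmp => _ [m _ <-].
rewrite leNgt; apply/negP => inf0.
(* Half of a finite positive infimum lies strictly below every value; for an infimum [+oo] the value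
   1 serves. *)
have [d d0 dG] : exists2 d : R, 0 < d & forall m, (d%:E < mu (G m))%E.
  have lb m : (ereal_inf (range (fun m => mu (G m))) <= mu (G m))%E.
    by apply: ereal_inf_lbound; exists m.
  move: inf0 lb; case: ereal_inf => [x| |] //.
    rewrite lte_fin => x0 lb; exists (x / 2); first by rewrite divr_gt0.
    by move=> m; apply: lt_le_trans (lb m); rewrite lte_fin; lra.
  move=> _ lb; exists 1 => // m; apply: lt_le_trans (lb m); exact: ltry.
(* Chosen so that the saving [m * d] exceeds [r + c], which pushes the upper bound [n + c - m * d]
   below [n - r]. *)
pose m := (Num.truncn ((r + c)%:R / d)).+1.
have md : (r + c)%:R < m%:R * d.
  by rewrite -ltr_pdivrMr// truncnS_gt.
have := dG (2 * m)%N; rewrite GE => /covered_measure[N HN].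
(* Beyond [N] the covered strings carry mass at least [d]; beyond [2 * m] the average bound
   applies. *)
have [n nN] := hmu (maxn N (2 * m)).
move: nN; rewrite geq_max => /andP[nN nm].
move=> /le_trans/(_ (Hc m n d nm (HN n nN))).
rewrite lee_fin; move: md; rewrite natrD; lra.
Qed.
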